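(* Let $\mathcal{X}$ and $\mathcal{C}$ be skew monoidal categories and let there be a weak action of $\mathcal{X}$ on $\mathcal{C}$. Then the semidirect product $\mathcal{X} \ltimes \mathcal{C}$, with unit $\mathcal{I} = \langle \mathcal{I}_{\mathcal{X}}, \mathcal{I}_{\mathcal{C}} \rangle$, satisfies the unitor identity \[ \rho_{\mathcal{I}} \circ \lambda_{\mathcal{I}} = \mathrm{id}_{\mathcal{I}}. \]
   Context: An object's name also denotes its identity morphism. Skew monoidal category: a category with a functor $\otimes$ in two variables, an object $\mathcal{I}$, and natural transformations (not necessarily invertible) $\alpha_{A,B,C} \colon A \otimes (B \otimes C) \to (A \otimes B) \otimes C$, $\lambda_A \colon A \to \mathcal{I} \otimes A$, $\rho_A \colon A \otimes \mathcal{I} \to A$ satisfying: the pentagon identity $\alpha_{A \otimes B, C, D} \circ \alpha_{A, B, C \otimes D} = (\alpha_{A,B,C} \otimes D) \circ \alpha_{A, B \otimes C, D} \circ (A \otimes \alpha_{B,C,D})$; the three triangle identities $\alpha_{\mathcal{I},A,B} \circ \lambda_{A \otimes B} = \lambda_A \otimes B$, $(\rho_A \otimes B) \circ \alpha_{A,\mathcal{I},B} \circ (A \otimes \lambda_B) = \mathrm{id}_{A \otimes B}$, $\rho_{A \otimes B} \circ \alpha_{A,B,\mathcal{I}} = A \otimes \rho_B$; and the unitor identity $\rho_{\mathcal{I}} \circ \lambda_{\mathcal{I}} = \mathrm{id}_{\mathcal{I}}$. Weak action of $\mathcal{X}$ on $\mathcal{C}$: an oplax monoidal functor $\Gamma$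 from $\mathcal{X}$ to the strict monoidal category of lax monoidal endofunctors of $\mathcal{C}$ and monoidal natural transformations, with tensor product given by composition in diagrammatic order. Explicitly: (1) for each object $X$ of $\mathcal{X}$, a functor $(-)^X \colon \mathcal{C} \to \mathcal{C}$ with a natural transformation $\varphi^X_{B,C} \colon B^X \otimes C^X \to (B \otimes C)^X$ and a morphism $\varphi^X \colon \mathcal{I}_{\mathcal{C}} \to \mathcal{I}_{\mathcal{C}}^X$ such that $(\alpha_{A,B,C})^X \circ \varphi^X_{A,B \otimes C} \circ (A^X \otimes \varphi^X_{B,C}) = \varphi^X_{A \otimes B, C} \circ (\varphi^X_{A,B} \otimes C^X) \circ \alpha_{A^X,B^X,C^X}$, $\varphi^X_{\mathcal{I}_{\mathcal{C}},C} \circ (\varphi^X \otimes C^X) \circ \lambda_{C^X} = (\lambda_C)^X$, and $(\rho_C)^X \circ \varphi^X_{C,\mathcal{I}_{\mathcal{C}}} \circ (C^X \otimes \varphi^X) = \rho_{C^X}$; (2) for each $f \colon X \to Y$ in $\mathcal{X}$, functorially in $f$, a natural transformation $(-)^f \colon (-)^X \to (-)^Y$ with $\varphi^Y_{B,C} \circ (B^f \otimes C^f) = (B \otimes C)^f \circ \varphi^X_{B,C}$ and $\mathcal{I}_{\mathcal{C}}^f \circ \varphi^X = \varphi^Y$; (3) morphisms $\psi^{X,Y}_C \colon C^{X \otimes Y} \to (C^X)^Y$, natural in $X, Y, C$, and $\psi_C \colon C^{\mathcal{I}_{\mathcal{X}}} \to C$, natural in $C$, such that $(\psi^{X,Y}_C)^Z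 \circ \psi^{X \otimes Y,Z}_C \circ C^{\alpha_{X,Y,Z}} = \psi^{Y,Z}_{C^X} \circ \psi^{X,Y \otimes Z}_C$, $(\psi_C)^X \circ \psi^{\mathcal{I}_{\mathcal{X}},X}_C \circ C^{\lambda_X} = \mathrm{id}_{C^X}$, and $\psi_{C^X} \circ \psi^{X,\mathcal{I}_{\mathcal{X}}}_C = C^{\rho_X}$; (4) these are monoidal natural transformations: $\psi^{X,Y}_{B \otimes C} \circ \varphi^{X \otimes Y}_{B,C} = (\varphi^X_{B,C})^Y \circ \varphi^Y_{B^X,C^X} \circ (\psi^{X,Y}_B \otimes \psi^{X,Y}_C)$, $\psi^{X,Y}_{\mathcal{I}_{\mathcal{C}}} \circ \varphi^{X \otimes Y} = (\varphi^X)^Y \circ \varphi^Y$, $\psi_{B \otimes C} \circ \varphi^{\mathcal{I}_{\mathcal{X}}}_{B,C} = \psi_B \otimes \psi_C$, and $\psi_{\mathcal{I}_{\mathcal{C}}} \circ \varphi^{\mathcal{I}_{\mathcal{X}}} = \mathrm{id}_{\mathcal{I}_{\mathcal{C}}}$. Semidirect product $\mathcal{X} \ltimes \mathcal{C}$: the underlying category is $\mathcal{X} \times \mathcal{C}$, with objects written $\langle X, C \rangle$. The tensor product is $\langle X, B \rangle \otimes \langle Y, C \rangle = \langle X \otimes Y, B^Y \otimes C \rangle$ (and correspondingly on morphisms) and the unit is $\langle \mathcal{I}_{\mathcal{X}}, \mathcal{I}_{\mathcal{C}} \rangle$. The structure maps are given by their components in $\mathcal{X}$ and in $\mathcal{C}$.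 Their $\mathcal{X}$-components are the structure maps $\alpha_{X,Y,Z}$, $\lambda_X$, $\rho_X$ of $\mathcal{X}$. Their $\mathcal{C}$-components are: for $\alpha_{\langle X,A \rangle, \langle Y,B \rangle, \langle Z,C \rangle}$, the composite $(\varphi^Z_{A^Y,B} \otimes C) \circ \alpha_{(A^Y)^Z,B^Z,C} \circ (\psi^{Y,Z}_A \otimes (B^Z \otimes C)) \colon A^{Y \otimes Z} \otimes (B^Z \otimes C) \to (A^Y \otimes B)^Z \otimes C$; for $\lambda_{\langle X,C \rangle}$, the composite $(\varphi^X \otimes C) \circ \lambda_C \colon C \to \mathcal{I}_{\mathcal{C}}^X \otimes C$; for $\rho_{\langle X,C \rangle}$, the composite $\rho_C \circ (\psi_C \otimes \mathcal{I}_{\mathcal{C}}) \colon C^{\mathcal{I}_{\mathcal{X}}} \otimes \mathcal{I}_{\mathcal{C}} \to C$. *)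

(* Defs.v *)
(** Skew monoidal categories, weak actions and semidirect products, over a
    minimal theory of categories whose morphisms are compared by Leibniz
    equality.  Plain Rocq, no library beyond the prelude. *)

Set Implicit Arguments.
Unset Strict Implicit.
Unset Printing Implicit Defensive.

Declare Scope cat_scope.
Delimit Scope cat_scope with cat.
Open Scope cat_scope.

Reserved Notation "g ∘ f" (at level 40, left associativity).
Reserved Notation "A ⊗ B" (at level 35, right associativity).
Reserved Notation "f ⊠ g" (at level 35, right associativity).

Record Category := {
  ob :> Type;
  hom : ob -> ob -> Type;
  id : forall A, hom A A;
  comp : forall A B C, hom B C -> hom A B -> hom A C;
  comp_id_l : forall A B (f : hom A B), comp (id B) f = f;
  comp_id_r : forall A B (f : hom A B), comp f (id A) = f;
  comp_assoc : forall A B C D (h : hom C D) (g : hom B C) (f : hom A B),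
    comp h (comp g f) = comp (comp h g) f
}.

Arguments hom {c} A B.
Arguments id {c} A.
Arguments comp {c A B C} g f.

Notation "g ∘ f" := (comp g f) : cat_scope.

Record Functor (C D : Category) := {
  fob :> C -> D;
  fmap : forall A B : C, hom A B -> hom (fob A) (fob B);
  fmap_id : forall A : C, fmap (id A) = id (fob A);
  fmap_comp : forall (A B E : C) (g : hom B E) (f : hom A B),
    fmap (g ∘ f) = fmap g ∘ fmap f
}.

Arguments fmap {C D} F {A B} f : rename.

Lemma pair_eq (S T : Type) (s s' : S) (t t' : T) :
  s = s' -> t = t' -> (s, t) = (s', t').
Proof. now intros -> ->. Qed.

Definition product (C D : Category) : Category.
Proof.
refine
  {| ob := C * D;
     hom := fun P Q => (hom (fst P) (fst Q) * hom (snd P) (snd Q))%type;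
     id := fun P => (id (fst P), id (snd P));
     comp := fun P Q R g f => (fst g ∘ fst f, snd g ∘ snd f) |}.
- intros A B [f f']; apply pair_eq; apply comp_id_l.
- intros A B [f f']; apply pair_eq; apply comp_id_r.
- intros; apply pair_eq; apply comp_assoc.
Defined.

Definition ob2 (C D E : Category) (F : Functor (product C D) E)
    (A : C) (B : D) : E := F (A, B).

Definition map2 (C D E : Category) (F : Functor (product C D) E)
    (A A' : C) (B B' : D) (f : hom A A') (g : hom B B') :
    hom (ob2 F A B) (ob2 F A' B') :=
  @fmap _ _ F (A, B) (A', B') (f, g).

(** The data of a skew monoidal category: the three transformations are
    natural, but no coherence identity is required. *)
Record SkewData := {
  carrier :> Category;
  tensor : Functor (product carrier carrier) carrier;
  unit : carrier;
  alpha : forall A B C : carrier,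
    hom (ob2 tensor A (ob2 tensor B C)) (ob2 tensor (ob2 tensor A B) C);
  lambda : forall A : carrier, hom A (ob2 tensor unit A);
  rho : forall A : carrier, hom (ob2 tensor A unit) A;
  alpha_natural : forall (A A' B B' C C' : carrier)
      (a : hom A A') (b : hom B B') (c : hom C C'),
    alpha A' B' C' ∘ map2 tensor a (map2 tensor b c)
    = map2 tensor (map2 tensor a b) c ∘ alpha A B C;
  lambda_natural : forall (A A' : carrier) (a : hom A A'),
    lambda A' ∘ a = map2 tensor (id unit) a ∘ lambda A;
  rho_natural : forall (A A' : carrier) (a : hom A A'),
    rho A' ∘ map2 tensor a (id unit) = a ∘ rho A
}.

Arguments unit {s}.
Arguments alpha {s} A B C.
Arguments lambda {s} A.
Arguments rho {s} A.

Notation "A ⊗ B" := (ob2 (tensor _) A B) : cat_scope.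
Notation "f ⊠ g" := (map2 (tensor _) f g) : cat_scope.

Record SkewMonoidal := {
  skew_data :> SkewData;
  pentagon : forall A B C D : skew_data,
    alpha (A ⊗ B) C D ∘ alpha A B (C ⊗ D)
    = (alpha A B C ⊠ id D) ∘ alpha A (B ⊗ C) D ∘ (id A ⊠ alpha B C D);
  triangle_l : forall A B : skew_data,
    alpha unit A B ∘ lambda (A ⊗ B) = lambda A ⊠ id B;
  triangle_m : forall A B : skew_data,
    (rho A ⊠ id B) ∘ alpha A unit B ∘ (id A ⊠ lambda B) = id (A ⊗ B);
  triangle_r : forall A B : skew_data,
    rho (A ⊗ B) ∘ alpha A B unit = id A ⊠ rho B;
  unitor : rho unit ∘ lambda unit = id (unit : skew_data)
}.

(** [pow X] is the endofunctor (-)^X and [powm f B] is the component at [B] of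
    the transformation (-)^f; [phi], [phi0] make [pow X] lax monoidal, and
    [psi], [psi0] are the oplax structure of X |-> (-)^X. *)
Record WeakAction (X C : SkewMonoidal) := {
  pow : X -> Functor C C;
  phi : forall (x : X) (B D : C), hom (pow x B ⊗ pow x D) (pow x (B ⊗ D));
  phi0 : forall x : X, hom (unit : C) (pow x unit);
  phi_natural : forall (x : X) (B B' D D' : C) (b : hom B B') (d : hom D D'),
    phi x B' D' ∘ (fmap (pow x) b ⊠ fmap (pow x) d)
    = fmap (pow x) (b ⊠ d) ∘ phi x B D;
  phi_alpha : forall (x : X) (A B D : C),
    fmap (pow x) (alpha A B D) ∘ phi x A (B ⊗ D) ∘ (id (pow x A) ⊠ phi x B D)
    = phi x (A ⊗ B) D ∘ (phi x A B ⊠ id (pow x D))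
      ∘ alpha (pow x A) (pow x B) (pow x D);
  phi_lambda : forall (x : X) (D : C),
    phi x unit D ∘ (phi0 x ⊠ id (pow x D)) ∘ lambda (pow x D)
    = fmap (pow x) (lambda D);
  phi_rho : forall (x : X) (D : C),
    fmap (pow x) (rho D) ∘ phi x D unit ∘ (id (pow x D) ⊠ phi0 x)
    = rho (pow x D);

  powm : forall (x y : X) (f : hom x y) (B : C), hom (pow x B) (pow y B);
  powm_natural : forall (x y : X) (f : hom x y) (B B' : C) (b : hom B B'),
    powm f B' ∘ fmap (pow x) b = fmap (pow y) b ∘ powm f B;
  powm_id : forall (x : X) (B : C), powm (id x) B = id (pow x B);
  powm_comp : forall (x y z : X) (g : hom y z) (f : hom x y) (B : C),
    powm (g ∘ f) B = powm g B ∘ powm f B;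
  powm_phi : forall (x y : X) (f : hom x y) (B D : C),
    phi y B D ∘ (powm f B ⊠ powm f D) = powm f (B ⊗ D) ∘ phi x B D;
  powm_phi0 : forall (x y : X) (f : hom x y),
    powm f unit ∘ phi0 x = phi0 y;

  psi : forall (x y : X) (D : C), hom (pow (x ⊗ y) D) (pow y (pow x D));
  psi0 : forall D : C, hom (pow unit D) D;
  psi_natural_1 : forall (x x' y : X) (f : hom x x') (D : C),
    psi x' y D ∘ powm (f ⊠ id y) D = fmap (pow y) (powm f D) ∘ psi x y D;
  psi_natural_2 : forall (x y y' : X) (g : hom y y') (D : C),
    psi x y' D ∘ powm (id x ⊠ g) D = powm g (pow x D) ∘ psi x y D;
  psi_natural_3 : forall (x y : X) (D D' : C) (d : hom D D'),
    psi x y D' ∘ fmap (pow (x ⊗ y)) d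
    = fmap (pow y) (fmap (pow x) d) ∘ psi x y D;
  psi0_natural : forall (D D' : C) (d : hom D D'),
    psi0 D' ∘ fmap (pow unit) d = d ∘ psi0 D;
  psi_alpha : forall (x y z : X) (D : C),
    fmap (pow z) (psi x y D) ∘ psi (x ⊗ y) z D ∘ powm (alpha x y z) D
    = psi y z (pow x D) ∘ psi x (y ⊗ z) D;
  psi_lambda : forall (x : X) (D : C),
    fmap (pow x) (psi0 D) ∘ psi unit x D ∘ powm (lambda x) D = id (pow x D);
  psi_rho : forall (x : X) (D : C),
    psi0 (pow x D) ∘ psi x unit D = powm (rho x) D;

  psi_phi : forall (x y : X) (B D : C),
    psi x y (B ⊗ D) ∘ phi (x ⊗ y) B D
    = fmap (pow y) (phi x B D) ∘ phi y (pow x B) (pow x D)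
      ∘ (psi x y B ⊠ psi x y D);
  psi_phi0 : forall x y : X,
    psi x y unit ∘ phi0 (x ⊗ y) = fmap (pow y) (phi0 x) ∘ phi0 y;
  psi0_phi : forall B D : C,
    psi0 (B ⊗ D) ∘ phi unit B D = psi0 B ⊠ psi0 D;
  psi0_phi0 : psi0 unit ∘ phi0 unit = id (unit : C)
}.

Section TensorFacts.

Variable S : SkewData.

Lemma tensor_id (A B : S) : id A ⊠ id B = id (A ⊗ B).
Proof. exact (fmap_id (tensor S) (A, B)). Qed.

Lemma tensor_comp (A A' A'' B B' B'' : S)
    (f' : hom A' A'') (f : hom A A') (g' : hom B' B'') (g : hom B B') :
  (f' ∘ f) ⊠ (g' ∘ g) = (f' ⊠ g') ∘ (f ⊠ g).
Proof.
exact (@fmap_comp _ _ (tensor S) (A, B) (A', B') (A'', B'') (f', g') (f, g)).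
Qed.

End TensorFacts.

Section ActionFacts.

Variables (X C : SkewMonoidal) (G : WeakAction X C).

(** b^f : B^x -> B'^y for f : x -> y and b : B -> B'; by [powm_natural] the
    other composite, through [pow G y B], is equal. *)
Definition powb (x y : X) (f : hom x y) (B B' : C) (b : hom B B') :
    hom (pow G x B) (pow G y B') :=
  powm G f B' ∘ fmap (pow G x) b.

Lemma powb_id (x : X) (B : C) : powb (id x) (id B) = id (pow G x B).
Proof. unfold powb; rewrite powm_id, fmap_id; apply comp_id_l. Qed.

Lemma powb_comp (x y z : X) (g : hom y z) (f : hom x y) (B B' B'' : C)
    (b' : hom B' B'') (b : hom B B') :
  powb (g ∘ f) (b' ∘ b) = powb g b' ∘ powb f b.
Proof.
unfold powb; rewrite powm_comp, fmap_comp, !comp_assoc; f_equal.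
now rewrite <- !comp_assoc, powm_natural.
Qed.

Lemma powb_id_l (x : X) (B B' : C) (b : hom B B') :
  powb (id x) b = fmap (pow G x) b.
Proof. unfold powb; rewrite powm_id; apply comp_id_l. Qed.

Lemma phi_powb (x y : X) (f : hom x y) (B B' D D' : C)
    (b : hom B B') (d : hom D D') :
  phi G y B' D' ∘ (powb f b ⊠ powb f d) = powb f (b ⊠ d) ∘ phi G x B D.
Proof.
unfold powb; rewrite tensor_comp, comp_assoc, powm_phi, <- comp_assoc.
now rewrite phi_natural, comp_assoc.
Qed.

Lemma phi0_powb (x y : X) (f : hom x y) :
  powb f (id unit) ∘ phi0 G x = phi0 G y.
Proof. unfold powb; rewrite fmap_id, comp_id_r; apply powm_phi0. Qed.

Lemma psi_powb (x x' y y' : X) (f : hom x x') (g : hom y y') (D D' : C)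
    (d : hom D D') :
  psi G x' y' D' ∘ powb (f ⊠ g) d = powb g (powb f d) ∘ psi G x y D.
Proof.
unfold powb.
assert (E : f ⊠ g = (id x' ⊠ g) ∘ (f ⊠ id y))
  by now rewrite <- tensor_comp, comp_id_l, comp_id_r.
rewrite E, powm_comp, !comp_assoc, psi_natural_2.
rewrite <- (comp_assoc _ (psi G x' y D') _), psi_natural_1.
rewrite <- !comp_assoc, psi_natural_3.
now rewrite fmap_comp, <- !comp_assoc.
Qed.

Lemma sd_alpha_natural (y y' z z' : X) (g : hom y y') (h : hom z z')
    (A A' B B' D D' : C) (a : hom A A') (b : hom B B') (d : hom D D') :
  (phi G z' (pow G y' A') B' ⊠ id D')
  ∘ alpha (pow G z' (pow G y' A')) (pow G z' B') D'
  ∘ (psi G y' z' A' ⊠ id (pow G z' B' ⊗ D'))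
  ∘ (powb (g ⊠ h) a ⊠ (powb h b ⊠ d))
  = (powb h (powb g a ⊠ b) ⊠ d)
    ∘ ((phi G z (pow G y A) B ⊠ id D)
       ∘ alpha (pow G z (pow G y A)) (pow G z B) D
       ∘ (psi G y z A ⊠ id (pow G z B ⊗ D))).
Proof.
rewrite <- !comp_assoc, <- tensor_comp, psi_powb, comp_id_l.
rewrite <- (comp_id_r (powb h b ⊠ d)), tensor_comp.
rewrite (comp_assoc (alpha _ _ _)), alpha_natural.
rewrite !comp_assoc, <- !tensor_comp, phi_powb, comp_id_l, comp_id_r.
reflexivity.
Qed.

Lemma sd_lambda_natural (x x' : X) (f : hom x x') (A A' : C) (a : hom A A') :
  (phi0 G x' ⊠ id A') ∘ lambda A' ∘ a
  = (powb f (id unit) ⊠ a) ∘ ((phi0 G x ⊠ id A) ∘ lambda A).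
Proof.
rewrite <- !comp_assoc, lambda_natural, !comp_assoc, <- !tensor_comp.
now rewrite phi0_powb, comp_id_l, !comp_id_r.
Qed.

Lemma sd_rho_natural (A A' : C) (a : hom A A') :
  rho A' ∘ (psi0 G A' ⊠ id unit) ∘ (powb (id unit) a ⊠ id unit)
  = a ∘ (rho A ∘ (psi0 G A ⊠ id unit)).
Proof.
rewrite <- !comp_assoc, <- tensor_comp, powb_id_l, psi0_natural, comp_id_l.
rewrite (comp_assoc a), <- rho_natural, <- comp_assoc, <- tensor_comp.
now rewrite comp_id_l.
Qed.

Definition sd_tensor : Functor (product (product X C) (product X C))
                               (product X C).
Proof.
refine (@Build_Functor
  (product (product X C) (product X C)) (product X C)
  (fun P => (fst (fst P) ⊗ fst (snd P),
             pow G (fst (snd P)) (snd (fst P)) ⊗ snd (snd P)))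
  (fun P Q h => (fst (fst h) ⊠ fst (snd h),
                 powb (fst (snd h)) (snd (fst h)) ⊠ snd (snd h))) _ _).
- intros P; apply pair_eq; simpl.
  + apply tensor_id.
  + rewrite powb_id; apply tensor_id.
- intros P Q R h k; apply pair_eq; simpl.
  + apply tensor_comp.
  + rewrite powb_comp; apply tensor_comp.
Defined.

Definition sd_unit : product X C := (unit, unit).

Definition sd_alpha (P Q R : product X C) :
  @hom (product X C) (sd_tensor (P, sd_tensor (Q, R)))
                     (sd_tensor (sd_tensor (P, Q), R)) :=
  let x := fst P in let y := fst Q in let z := fst R in
  let A := snd P in let B := snd Q in let D := snd R in
  (alpha x y z,
   (phi G z (pow G y A) B ⊠ id D)
   ∘ alpha (pow G z (pow G y A)) (pow G z B) D
   ∘ (psi G y z A ⊠ id (pow G z B ⊗ D))).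

Definition sd_lambda (P : product X C) :
  @hom (product X C) P (sd_tensor (sd_unit, P)) :=
  let x := fst P in let D := snd P in
  (lambda x, (phi0 G x ⊠ id D) ∘ lambda D).

Definition sd_rho (P : product X C) :
  @hom (product X C) (sd_tensor (P, sd_unit)) P :=
  let x := fst P in let D := snd P in
  (rho x, rho D ∘ (psi0 G D ⊠ id unit)).

Definition semidirect : SkewData.
Proof.
refine (@Build_SkewData (product X C) sd_tensor sd_unit
          sd_alpha sd_lambda sd_rho _ _ _).
- intros [x A] [x' A'] [y B] [y' B'] [z D] [z' D'] [f a] [g b] [h d].
  exact (pair_eq (alpha_natural f g h) (sd_alpha_natural g h a b d)).
- intros [x A] [x' A'] [f a].
  exact (pair_eq (lambda_natural f) (sd_lambda_natural f a)).
- intros [x A] [x' A'] [f a].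
  exact (pair_eq (rho_natural f) (sd_rho_natural a)).
Defined.

End ActionFacts.

(* Main.v *)
Require Import Defs.

(** Equality is checked componentwise. The first component is the unitor identity of [X]. In the
    second, [psi0] and [phi0] meet between [rho] and [lambda] and cancel, because the counit of the
    action is a monoidal transformation ([psi0_phi0]); the unitor identity of [C] remains. *)

Theorem lemma4p4 (X C : SkewMonoidal) (G : WeakAction X C) :
  rho (s := semidirect G) unit ∘ lambda (s := semidirect G) unit
  = id (unit : semidirect G).
Proof.
apply pair_eq; [exact (unitor X)|].
change (rho (unit : C) ∘ (psi0 G unit ⊠ id unit)
        ∘ ((phi0 G unit ⊠ id unit) ∘ lambda unit) = id (unit : C)).
(* Reassociate so that functoriality of the tensor fuses the two middle maps into [psi0 ∘ phi0] on
   the left factor. *)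
rewrite comp_assoc, <- (comp_assoc (rho _)), <- tensor_comp.
rewrite psi0_phi0, comp_id_l, tensor_id, comp_id_r.
exact (unitor C).
Qed.
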